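(* Let $H$ be a finite simple connected graph, let $\Delta$ be the largest degree of $H$, and let $t(H)$ be the largest root of the matching polynomial $M(H,t)$ of $H$. Then the critical edge density $d_{crit}(H)$ of $H$ satisfies $$d_{crit}(H)\le 1-\frac{1}{t(H)^2}.$$ In particular, $$d_{crit}(H)<1-\frac{1}{4(\Delta-1)}.$$
   Context: The matching polynomial of a graph $H$ on $n$ vertices is $M(H,t)=\sum_{k\ge 0}(-1)^k m_k(H)t^{n-2k}$, where $m_k(H)$ is the number of matchings of $H$ with exactly $k$ edges ($m_0(H)=1$). A weighted blow-up graph $G[H]$ of $H$ is a graph whose vertex set is the disjoint union of finite nonempty clusters $A_v$ ($v\in V(H)$), whose edges only join vertices of $A_u$ to vertices of $A_v$ with $uv\in E(H)$ (not necessarily all such pairs), together with non-negative vertex weights $w$ such that the total weight of each cluster is $1$. For $uv\in E(H)$ the density is $d(A_u,A_v)=\sum w(x)w(y)$, the sum running over all edges $xy$ of $G[H]$ with $x\in A_u$, $y\in A_v$. $G[H]$ contains $H$ as a transversal if one can choose $\varphi(v)\in A_v$ for every $v\in V(H)$ such that $\varphi(u)\varphi(v)\in E(G[H])$ for every $uv\in E(H)$. The critical edge density $d_{crit}(H)$ is the supremum of all $d\in[0,1]$ for which there is a weighted blow-up graph of $H$ with $d(A_u,A_v)\ge d$ for all $uv\in E(H)$ that does not contain $H$ as a transversal. *)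

(* Defs.v *)
From mathcomp Require Import all_boot all_order all_algebra.
From mathcomp Require Import boolp classical_sets reals.
Set Implicit Arguments.
Unset Strict Implicit.
Unset Printing Implicit Defensive.
Import Order.TTheory GRing.Theory Num.Theory.
Local Open Scope ring_scope.

Definition simple_graph (T : Type) (e : rel T) : Prop :=
  symmetric e /\ irreflexive e.

Definition connected_graph (T : finType) (e : rel T) : Prop :=
  (0 < #|T|)%N /\ forall x y : T, connect e x y.

Definition max_degree (T : finType) (e : rel T) : nat :=
  \max_(x : T) #|[set y | e x y]|.

Definition edge_set (T : finType) (e : rel T) : {set {set T}} :=
  [set [set p.1; p.2] | p : T * T & e p.1 p.2].

Definition matchings (T : finType) (e : rel T) (k : nat) : {set {set {set T}}} :=
  [set M : {set {set T}} | [&& M \subset edge_set e, finset.trivIset M & #|M| == k]].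

(* A matching with k edges covers 2k vertices, so no term is lost by summing
   over k <= n/2 only, and the subtraction below never truncates. *)
Definition matching_poly (R : realType) (T : finType) (e : rel T) : {poly R} :=
  \sum_(k < #|T|./2.+1)
    ((-1) ^+ k * #|matchings e k|%:R) *: 'X^(#|T| - 2 * k).

(* The default value 0 is only returned when p has no largest real root. *)
Definition largest_root (R : realType) (p : {poly R}) : R :=
  xget 0 [set t : R | root p t /\ forall s : R, root p s -> s <= t]%classic.

(* The clusters are the fibres of [cluster]. *)
Record weighted_blowup (R : realType) (T : finType) (e : rel T) := WeightedBlowup {
  bvertex : finType;
  cluster : bvertex -> T;
  bedge : rel bvertex;
  bweight : bvertex -> R;
  bedge_simple : simple_graph bedge;
  cluster_nonempty : forall v : T, exists x : bvertex, cluster x = v;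
  bedge_cluster : forall x y : bvertex, bedge x y -> e (cluster x) (cluster y);
  bweight_ge0 : forall x : bvertex, 0 <= bweight x;
  bweight_sum1 : forall v : T, \sum_(x | cluster x == v) bweight x = 1
}.

Definition density (R : realType) (T : finType) (e : rel T)
    (G : weighted_blowup R e) (u v : T) : R :=
  \sum_(x : bvertex G | cluster x == u)
    \sum_(y : bvertex G | (cluster y == v) && bedge x y)
      bweight x * bweight y.

Definition has_transversal (R : realType) (T : finType) (e : rel T)
    (G : weighted_blowup R e) : Prop :=
  exists phi : T -> bvertex G,
    (forall v : T, cluster (phi v) = v) /\
    (forall u v : T, e u v -> bedge (phi u) (phi v)).

(* For the one-vertex graph the set is empty, and its [sup] is 0. *)
Definition dcrit (R : realType) (T : finType) (e : rel T) : R :=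
  sup [set d : R | 0 <= d <= 1 /\
    exists G : weighted_blowup R e,
      (forall u v : T, e u v -> d <= density G u v) /\ ~ has_transversal G]%classic.

(* Main.v *)
Require Import Defs.
From mathcomp Require Import all_boot all_order all_algebra.
From mathcomp Require Import boolp classical_sets reals.
From mathcomp Require Import polyrcf ring lra.
Import Order.TTheory GRing.Theory Num.Theory.
Local Open Scope ring_scope.

(** Let G be a blow-up of H whose densities are all at least d, and pick
    independently in every cluster a vertex according to the weights.  For an
    edge f of H let B_f be the bad event that the two vertices picked over the
    ends of f are not adjacent.  Then B_f has probability at most p = 1 - d and
    is independent of what happens on the edges disjoint from f, so the
    dependency graph is the line graph of H, and its independent sets are the
    matchings of H.  Shearer's form of the local lemma says that all bad events
    are avoided with positive probability, whence a transversal, as soon as the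
    signed matching sums
      F_S(p) = \sum_(M matching in S) (- p) ^ #|M|
    are positive for every set S of edges of H.  The reason is that F_S
    satisfies with equality the recursion
      F_S = F_(S - f) - p F_(edges of S disjoint from f)
    that the probability of avoiding all B_g, g in S, satisfies as an
    inequality, so that probability grows at least as fast as F_S
    ([prob_joined_rec], [shearer_ratio]).

    Positivity on [0, p] passes from the whole edge set E to its subsets
    ([matching_gen_gt0_sub]), so only F_E matters, and
      M(H, s) = s ^ n F_E(1 / s ^ 2).
    The smallest positive root of F_E is therefore 1 / t(H) ^ 2, which gives
    the first bound.

    For the second bound, when Delta >= 2, F_E is positive up to and including
    x0 = 1 / (4 (Delta - 1)), by the classical argument of Heilmann and Lieb
    ([matching_gen_gt0_degree]): at a vertex v of degree at most Delta - 1,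
    deleting the edges at v less than doubles F.  As x0 is not a root, F_E
    stays positive slightly beyond x0, and this gives the strict inequality. *)

Set Implicit Arguments.
Unset Strict Implicit.
Unset Printing Implicit Defensive.

(** * Sign changes of real polynomials *)

Lemma poly_ivt_decr (R : rcfType) (p : {poly R}) (a b : R) :
  a <= b -> 0 < p.[a] -> p.[b] <= 0 -> exists2 c, a < c <= b & root p c.
Proof.
move=> ab pa pb.
have [|c /andP[ac cb] rc] := @poly_ivt R (- p) a b ab.
  by rewrite !hornerN oppr_le0 oppr_ge0 pb ltW.
rewrite rootN in rc; exists c => //; rewrite cb andbT lt_neqAle ac andbT.
by apply: contraTneq rc => <-; rewrite rootE gt_eqF.
Qed.

Lemma first_root (R : rcfType) (p : {poly R}) (a b : R) :
    a <= b -> 0 < p.[a] -> p.[b] <= 0 ->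
  exists c, [/\ a < c <= b, p.[c] = 0 & forall z, a <= z < c -> 0 < p.[z]].
Proof.
move=> ab pa pb; have [z /andP[az zb] rz] := poly_ivt_decr ab pa pb.
case: (next_rootP p a (b + 1)) => [p0 | c _ pc cab norc | c _ _ norc].
- by rewrite p0 horner0 ltxx in pa.
- move: cab; rewrite in_itv /= => /andP[ac cb].
  exists c; split=> //.
    rewrite ac /= (le_trans _ zb) // leNgt; apply/negP => zc.
    by have := norc z; rewrite in_itv /= az zc rz => /(_ isT).
  move=> w /andP[aw wc]; rewrite ltNge; apply/negP => pw.
  have [y /andP[ay yw] ry] := poly_ivt_decr aw pa pw.
  by have := norc y; rewrite in_itv /= ay (le_lt_trans yw wc) ry => /(_ isT).
- have zb1 : z < b + 1 by lra.
  by have := norc z; rewrite in_itv /= az zb1 rz => /(_ isT).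
Qed.

(** * Signed matching sums *)

Definition avoid (T : finType) (S : {set {set T}}) (A : {set T}) :
    {set {set T}} :=
  [set f in S | [disjoint f & A]].

(** In a variable x this is the matching polynomial up to the substitution
    x = 1 / t ^ 2 and a power of t; it is the independence polynomial of the line graph at - x.
    Allowing any family S of sets makes it stable under edge deletions, without
    any change of the vertex set. *)
Definition matching_gen (R : comNzRingType) (T : finType) (S : {set {set T}}) :
    {poly R} :=
  \sum_(M : {set {set T}} | (M \subset S) && finset.trivIset M) (- 'X) ^+ #|M|.

Lemma avoid_sub (T : finType) (S : {set {set T}}) A : avoid S A \subset S.
Proof. by apply/fintype.subsetP => f; rewrite inE => /andP[]. Qed.

Lemma avoid_subD1 (T : finType) (S : {set {set T}}) f :
  f != finset.set0 -> avoid S f \subset S :\ f.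
Proof.
move=> f0; rewrite finset.subsetD1 avoid_sub inE negb_and /=.
by rewrite -setI_eq0 finset.setIid f0 orbT.
Qed.

Lemma avoidU (T : finType) (S : {set {set T}}) A B :
  avoid (avoid S A) B = avoid S (A :|: B).
Proof.
apply/setP => f; rewrite !inE -andbA; congr (_ && _).
by rewrite -!setI_eq0 finset.setIUr finset.setU_eq0.
Qed.

Lemma matching_genE (R : comNzRingType) (T : finType) (S : {set {set T}}) (x : R) :
  (matching_gen R S).[x] =
  \sum_(M : {set {set T}} | (M \subset S) && finset.trivIset M) (- x) ^+ #|M|.
Proof.
by rewrite horner_sum; apply: eq_bigr => M _; rewrite horner_exp hornerN hornerX.
Qed.

Lemma matching_gen_horner0 (R : comNzRingType) (T : finType) (S : {set {set T}}) :
  (matching_gen R S).[0] = 1.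
Proof.
rewrite matching_genE (bigD1 finset.set0) /=; last first.
  by rewrite finset.sub0set; apply/finset.trivIsetP => A B; rewrite inE.
rewrite cards0 expr0 big1 ?addr0 // => M /andP[_ M0].
by rewrite oppr0 expr0n cards_eq0 (negbTE M0).
Qed.

Lemma matching_gen_set0 (R : comNzRingType) (T : finType) (x : R) :
  (matching_gen R (finset.set0 : {set {set T}})).[x] = 1.
Proof.
rewrite matching_genE (big_pred1 finset.set0) ?cards0 ?expr0 // => M.
rewrite finset.subset0 /=; case: eqVneq => //= ->.
by apply/finset.trivIsetP => A B; rewrite inE.
Qed.

(** Matchings that contain f are f together with a matching avoiding f. *)
Lemma matching_gen_rec (R : comNzRingType) (T : finType) (S : {set {set T}}) f :
    f \in S -> f != finset.set0 ->
  matching_gen R S = matching_gen R (S :\ f) - 'X * matching_gen R (avoid S f).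
Proof.
move=> fS f0; rewrite /matching_gen (bigID (fun M : {set {set T}} => f \in M)) /=.
rewrite addrC; congr (_ + _).
  by apply: eq_bigl => M; rewrite finset.subsetD1 andbAC.
rewrite (reindex_onto (fun M => f |: M) (fun M => M :\ f)) /=; last first.
  by move=> M /andP[_ fM]; rewrite finset.setD1K.
(* As f is nonempty it does not avoid itself, so adding it to a matching
   avoiding f is reversible. *)
have fav (M : {set {set T}}) : M \subset avoid S f -> f \notin M.
  move=> MS; have := fintype.subset_trans MS (avoid_subD1 S f0).
  by rewrite finset.subsetD1 => /andP[].
rewrite -mulNr big_distrr; apply: eq_big => /= [M | M].
  rewrite finset.setU11 andbT; apply/andP/andP => [[/andP[sMS tM] /eqP fM] | [MS tM]].
    have {fM} fM : f \notin M by rewrite -fM !inE eqxx.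
    have sub : M \subset f |: M by apply: finset.subsetUr.
    split; last exact: finset.trivIsetS sub tM.
    apply/fintype.subsetP => g gM; rewrite inE (fintype.subsetP sMS) ?(fintype.subsetP sub) //=.
    move/finset.trivIsetP: tM; apply; rewrite ?inE ?eqxx ?gM ?orbT //.
    by apply: contraNneq fM => <-.
  rewrite finset.setU1K ?eqxx ?fav //; split=> //.
  rewrite finset.subUset finset.sub1set fS (fintype.subset_trans MS) ?avoid_sub //=.
  apply/finset.trivIsetP => A B; rewrite !inE.
  have disj g : g \in M -> [disjoint g & f].
    by move=> /(fintype.subsetP MS); rewrite inE => /andP[].
  case/predU1P=> [->|AM] /predU1P[->|BM] AB; first by rewrite eqxx in AB.
  - by rewrite disjoint_sym disj.
  - exact: disj.
  - by move/finset.trivIsetP: tM; apply.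
move=> /andP[_ /eqP fM].
by rewrite cardsU1 -{1}fM !inE eqxx exprS.
Qed.

(** A matching uses at most one of the edges at v: this is the edge recursion
    applied to these edges one after the other. *)
Lemma matching_gen_vertex (R : comNzRingType) (T : finType) (S : {set {set T}}) v :
  matching_gen R S = matching_gen R (avoid S [set v]) -
    'X * \sum_(f in S | v \in f) matching_gen R (avoid S f).
Proof.
have [n] := ubnP #|S|; elim: n S => // n IH S; rewrite ltnS => leSn.
have [f /andP[fS vf] | none] := pickP [pred f in S | v \in f].
  have f0 : f != finset.set0 by apply/finset.set0Pn; exists v.
  rewrite (matching_gen_rec R fS f0) IH; last first.
    by rewrite (leq_trans _ leSn) // [in X in (_ < X)%N](cardsD1 f) fS.
  have -> : avoid (S :\ f) [set v] = avoid S [set v].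
    apply/setP => g; rewrite !inE; case: (eqVneq g f) => //= ->.
    by rewrite disjoint_sym disjoints1 vf andbF.
  rewrite [in RHS](bigD1 f) ?fS //= mulrDr opprD addrA addrAC.
  congr (_ - _ * _ - _).
  apply: eq_big => [g | g]; first by rewrite !inE -andbA andbC.
  move=> /andP[_ vg]; congr matching_gen.
  apply/setP => h; rewrite !inE; case: (eqVneq h f) => //= ->.
  apply/esym/andP => -[_ /pred0P/(_ v)]; by rewrite /= vf vg.
rewrite big_pred0 // mulr0 subr0; congr matching_gen.
apply/setP => f; rewrite inE; case fS: (f \in S) => //=.
by rewrite disjoint_sym disjoints1; have := none f; rewrite /= fS /= => ->.
Qed.

(** Deleting edges can only increase the smallest positive root.  If F_(S - f)
    had a first root c <= x, the recursion at c would read F_S(c) = - c F_A(c)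
    with A the edges avoiding f; but A is contained in S - f, so by induction
    F_A is positive before c, hence F_A(c) >= 0 and F_S(c) <= 0. *)
Lemma matching_gen_gt0_sub (R : rcfType) (T : finType) (S S' : {set {set T}})
    (x : R) :
    finset.set0 \notin S -> S' \subset S -> 0 <= x ->
    (forall y, 0 <= y <= x -> 0 < (matching_gen R S).[y]) ->
  0 < (matching_gen R S').[x].
Proof.
have [n] := ubnP #|S|; elim: n S S' x => // n IH S S' x; rewrite ltnS => leSn.
move=> S0 S'S x0 posS; have [-> | neS] := eqVneq S' S.
  by apply: posS; rewrite x0 lexx.
have /fintype.properP[_ [f fS fS']] : S' \proper S by rewrite finset.properEneq neS.
have f0 : f != finset.set0 by apply: contraNneq S0 => <-.
have ltn : (#|S :\ f| < n)%N.
  by rewrite (leq_trans _ leSn) // [in X in (_ < X)%N](cardsD1 f) fS.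
have D0 : finset.set0 \notin S :\ f by rewrite inE (negbTE S0) andbF.
apply: (IH (S :\ f)) => //; first by rewrite finset.subsetD1 S'S.
move=> y /andP[y0 yx]; rewrite ltNge; apply/negP => negy.
have [|c [/andP[c0 cy] rc posD]] := first_root y0 _ negy.
  by rewrite matching_gen_horner0.
have cx : c <= x := le_trans cy yx.
have posA z : 0 <= z < c -> 0 < (matching_gen R (avoid S f)).[z].
  move=> /andP[z0 zc]; apply: (IH (S :\ f)) => //.
    exact: avoid_subD1.
  by move=> w /andP[w0 wz]; apply: posD; rewrite w0 (le_lt_trans wz).
have := posS c; rewrite (ltW c0) cx => /(_ isT).
rewrite (matching_gen_rec R fS f0) hornerD hornerN hornerM hornerX rc sub0r.
rewrite oppr_gt0 pmulr_rlt0 // => negA.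
have [|z /andP[z0 zc] rz] := poly_ivt_decr (ltW c0) _ (ltW negA).
  by rewrite matching_gen_horner0.
have zc' : z < c.
  by rewrite lt_neqAle zc andbT; apply: contraTneq rz => ->; rewrite rootE lt_eqF.
by have := posA z; rewrite (ltW z0) zc' (rootP rz) ltxx => /(_ isT).
Qed.

(** * Shearer's inequality *)

(** If F is a positive solution of a recursion of which P is a supersolution,
    then P / F is nondecreasing.  Inductively P (avoid S f) is at most
    F (avoid S f) P (S - f) / F (S - f), and substituting this in the
    inequality for P gives P (S - f) F S / F (S - f) as a lower bound of P S. *)
Lemma shearer_ratio (R : realFieldType) (T : finType) (E : {set {set T}})
    (F P : {set {set T}} -> R) (p : R) :
    finset.set0 \notin E -> 0 <= p ->
    (forall S : {set {set T}}, S \subset E -> 0 < F S) ->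
    (forall (S : {set {set T}}) f, S \subset E -> f \in S ->
       F S = F (S :\ f) - p * F (avoid S f)) ->
    (forall (S : {set {set T}}) f, S \subset E -> f \in S ->
       P (S :\ f) - p * P (avoid S f) <= P S) ->
  forall S S' : {set {set T}}, S' \subset S -> S \subset E -> P S' / F S' <= P S / F S.
Proof.
move=> E0 p0 Fpos Frec Prec S; have [n] := ubnP #|S|.
elim: n S => // n IH S; rewrite ltnS => leSn S' S'S SE.
have [-> // | neS] := eqVneq S' S.
have /fintype.properP[_ [f fS fS']] : S' \proper S by rewrite finset.properEneq neS.
have f0 : f != finset.set0.
  by apply: contraNneq E0 => <-; apply: (fintype.subsetP SE).
have ltn : (#|S :\ f| < n)%N.
  by rewrite (leq_trans _ leSn) // [in X in (_ < X)%N](cardsD1 f) fS.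
have DE : S :\ f \subset E := fintype.subset_trans (finset.subD1set S f) SE.
have AE : avoid S f \subset E := fintype.subset_trans (avoid_sub S f) SE.
apply: le_trans (IH _ ltn S' _ DE) _; first by rewrite finset.subsetD1 S'S.
have := IH _ ltn (avoid S f) (avoid_subD1 S f0) DE.
rewrite ler_pdivrMr ?Fpos // ler_pdivlMr ?Fpos // => leA.
apply: le_trans (Prec S f SE fS).
rewrite (Frec S f SE fS) mulrBr divfK ?gt_eqF ?Fpos // lerD2l lerN2 mulrCA.
by rewrite ler_wpM2l.
Qed.

(** * The Heilmann-Lieb bound *)

(** In the vertex recursion at v, the term of an edge uv deletes u from a graph
    in which u has lost that edge, so has degree at most b: by induction this
    term is less than twice F (avoid S [set v]).  With k edges at v this gives
    F S > F (avoid S [set v]) (1 - 2 x k), and since 4 b x <= 1 the last factor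
    is at least 1 / 2 for k <= b, and still nonnegative for k = b + 1. *)
Lemma matching_gen_gt0_degree (R : realFieldType) (T : finType) (S : {set {set T}})
    (b : nat) (x : R) :
    {in S, forall f : {set T}, #|f| = 2%N} ->
    (forall v, (#|[set f in S | v \in f]| <= b.+1)%N) ->
    (0 < b)%N -> 0 < x -> 4%:R * b%:R * x <= 1 ->
  0 < (matching_gen R S).[x] /\
  forall v, (#|[set f in S | v \in f]| <= b)%N ->
    (matching_gen R (avoid S [set v])).[x] < 2%:R * (matching_gen R S).[x].
Proof.
move=> S2 Sdeg b0 x0 bx; have b1 : (1 : R) <= b%:R by rewrite ler1n.
have [n] := ubnP #|S|; elim: n S S2 Sdeg => // n IH S S2 Sdeg; rewrite ltnS => leSn.
have key v f : f \in S -> v \in f ->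
    0 < (matching_gen R (avoid S [set v])).[x] /\
    (matching_gen R (avoid S [set v])).[x] *
      (1 - 2%:R * x * #|[set f in S | v \in f]|%:R) < (matching_gen R S).[x].
  move=> fS vf.
  have AS := avoid_sub S [set v].
  have A2 : {in avoid S [set v], forall f : {set T}, #|f| = 2%N}.
    by move=> g /(fintype.subsetP AS)/S2.
  have Asub u : [set f in avoid S [set v] | u \in f] \subset [set f in S | u \in f].
    by apply/fintype.subsetP => g; rewrite !inE -andbA => /and3P[-> _ ->].
  have Adeg u : (#|[set f in avoid S [set v] | u \in f]| <= b.+1)%N.
    exact: leq_trans (subset_leq_card (Asub u)) (Sdeg u).
  have fA : f \notin avoid S [set v] by rewrite inE disjoint_sym disjoints1 vf andbF.
  have ltA : (#|avoid S [set v]| < n)%N.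
    apply: leq_trans leSn; apply: proper_card; apply/fintype.properP.
    by split=> //; exists f.
  have [A0 Ahalf] := IH _ A2 Adeg ltA; split=> //.
  set A := (matching_gen R (avoid S [set v])).[x] in Ahalf *.
  have -> : (matching_gen R S).[x] =
      A - x * \sum_(f in S | v \in f) (matching_gen R (avoid S f)).[x].
    rewrite (matching_gen_vertex R S v) hornerD hornerN hornerM hornerX.
    by congr (_ - _ * _); rewrite horner_sum.
  rewrite mulrBr mulr1 ltrD2l ltrN2.
  rewrite [ltRHS](_ : _ = x * (#|[set f in S | v \in f]|%:R * (2%:R * A))); last by ring.
  rewrite ltr_pM2l // -sum1_card natr_sum big_distrl /=.
  rewrite [ltRHS](eq_bigl (fun g => (g \in S) && (v \in g))); last first.
    by move=> g; rewrite inE.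
  apply: ltr_sum => [|g /andP[gS vg]]; first by apply/hasP; exists f; rewrite ?mem_index_enum ?fS.
  rewrite mul1r.
  have /eqP/cards2P[a [c [ac gE]]] := S2 _ gS.
  have [u guv] : exists u, g = [set v] :|: [set u].
    move: vg; rewrite gE !inE => /orP[/eqP->|/eqP->]; first by exists c.
    by exists a; rewrite finset.setUC.
  rewrite guv -avoidU; apply: Ahalf; rewrite -ltnS.
  apply: leq_trans (Sdeg u); apply: proper_card; apply/fintype.properP.
  split=> //; exists g; first by rewrite inE gS guv !inE eqxx orbT.
  by rewrite !inE disjoint_sym disjoints1 vg andbF.
have posS : 0 < (matching_gen R S).[x].
  have [-> | [f fS]] := finset.set_0Vmem S; first by rewrite matching_gen_set0.
  have [v vf] : exists v, v \in f.
    by apply/finset.set0Pn; rewrite -card_gt0 S2.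
  have [A0 /(le_lt_trans _)] := key v f fS vf; apply.
  apply: mulr_ge0; first exact: ltW.
  have : (#|[set f in S | v \in f]|%:R : R) <= b%:R + 1 by rewrite natr1 ler_nat.
  move: (#|_|%:R : R) => k /(ler_wpM2l (ltW x0)) kb.
  have := ler_wpM2l (ltW x0) b1. lra.
split=> // v dv; have [f /andP[fS vf] | none] := pickP [pred f in S | v \in f].
  have [A0 lt1] := key v f fS vf.
  have : (#|[set f in S | v \in f]|%:R : R) <= b%:R by rewrite ler_nat.
  move: (#|_|%:R : R) lt1 => k lt1 /(ler_wpM2l (ltW x0)) kb.
  have half : 0 <= (1 : R) - 4%:R * (x * k) by lra.
  by have := mulr_ge0 (ltW A0) half; lra.
have -> : avoid S [set v] = S.
  apply/setP => f; rewrite inE; case fS: (f \in S) => //=.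
  by rewrite disjoint_sym disjoints1; have := none f; rewrite /= fS /= => ->.
by rewrite mulr2n mulrDl mul1r ltrDl.
Qed.

(** * The matching polynomial *)

Lemma card_edge (T : finType) (e : rel T) :
  irreflexive e -> {in edge_set e, forall f : {set T}, #|f| = 2%N}.
Proof.
move=> eirr f /finset.imsetP[[u v]]; rewrite inE /= => euv ->; rewrite cards2.
by case: eqVneq euv => // ->; rewrite eirr.
Qed.

Lemma matching_poly_gen (R : realType) (T : finType) (e : rel T) (s : R) :
    irreflexive e -> s != 0 ->
  (matching_poly R e).[s] =
  s ^+ #|T| * (matching_gen R (edge_set e)).[(s ^+ 2)^-1].
Proof.
move=> eirr s0; have cardM (M : {set {set T}}) :
    M \subset edge_set e -> finset.trivIset M -> (2 * #|M| <= #|T|)%N.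
  move=> ME /eqP tM; rewrite mulnC -sum_nat_const.
  apply: leq_trans (max_card (mem (finset.cover M))); rewrite -tM.
  by apply: leq_sum => f /(fintype.subsetP ME)/(card_edge eirr)->.
rewrite matching_genE /matching_poly horner_sum big_distrr /=.
rewrite (partition_big (fun M : {set {set T}} => inord #|M| : 'I_(#|T|./2.+1)) predT) //=.
apply: eq_bigr => k _; rewrite hornerZ hornerXn.
rewrite [RHS](eq_bigl (fun M => M \in matchings e k)); last first.
  move=> M; rewrite inE -andbA; apply: andb_id2l => ME; apply: andb_id2l => tM.
  rewrite -val_eqE /= inordK // ltnS.
  by have := cardM M ME tM; rewrite mul2n => /half_leq; rewrite doubleK.
rewrite (eq_bigr (fun _ => (-1) ^+ k * s ^+ (#|T| - 2 * k))); last first.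
  move=> M; rewrite inE => /and3P[ME tM /eqP kM]; have := cardM M ME tM.
  rewrite kM => k2; rewrite (exprNn (s ^+ 2)^-1) mulrCA; congr (_ * _).
  by rewrite -[X in s ^+ X * _](subnK k2) exprD -mulrA exprM
     -exprMn mulfV ?expr1n ?mulr1 ?expf_neq0.
by rewrite sumr_const -[RHS]mulr_natr mulrAC.
Qed.

(** * Random choice of one vertex in each cluster *)

(** The expectation of h under the product measure, when w has total mass 1 on
    each fibre of c. *)
Definition expect (R : realFieldType) (T V : finType) (c : V -> T) (w : V -> R)
    (h : {ffun T -> V} -> R) : R :=
  \sum_(phi : {ffun T -> V} | [forall v, c (phi v) == v])
    (\prod_v w (phi v)) * h phi.

Definition update (T V : finType) (phi : {ffun T -> V}) (v : T) (x : V) :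
    {ffun T -> V} :=
  [ffun u => if u == v then x else phi u].

Lemma expect1 (R : realFieldType) (T V : finType) (c : V -> T) (w : V -> R) :
    (forall v, \sum_(x | c x == v) w x = 1) ->
  expect c w (fun => 1) = 1.
Proof.
move=> w1; transitivity (\prod_(v : T) \sum_(x | c x == v) w x); last first.
  by rewrite big1.
rewrite (bigA_distr_big_dep (fun v x => c x == v)).
apply: eq_big => [phi | phi _]; last by rewrite mulr1.
exact/forallP/familyP.
Qed.

(** Drawing the value at v afresh does not change the law of phi, because the
    exchange of the old and the new value preserves the joint weight. *)
Lemma expect_resample (R : realFieldType) (T V : finType) (c : V -> T) (w : V -> R)
    (h : {ffun T -> V} -> R) (v : T) :
    \sum_(x | c x == v) w x = 1 ->
  expect c w h =
  expect c w (fun phi => \sum_(x | c x == v) w x * h (update phi v x)).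
Proof.
move=> w1; pose swap (q : {ffun T -> V} * V) := (update q.1 v q.2, q.1 v).
have swapK : involutive swap.
  move=> [phi x]; rewrite /swap /= ffunE eqxx; congr (_, _).
  by apply/ffunP => u; rewrite !ffunE; case: eqP => // ->.
transitivity (\sum_(phi : {ffun T -> V} | [forall u, c (phi u) == u])
    \sum_(x | c x == v) (\prod_u w (phi u)) * w x * h phi).
  apply: eq_bigr => phi _; rewrite -big_distrl -big_distrr /= w1.
  by rewrite mulr1.
rewrite /expect; under [RHS]eq_bigr => phi _ do rewrite big_distrr /=.
rewrite !pair_big /= (reindex_inj (inv_inj swapK)) /=.
apply: eq_big => [[phi x] | [phi x] _] /=.
  apply/andP/andP => -[/forallP valid /eqP cx]; split.
  - apply/forallP => u; have := valid u; rewrite /= ffunE.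
    by case: (eqVneq u v) => [-> _ | //]; rewrite cx.
  - by have := valid v; rewrite /= ffunE eqxx.
  - apply/forallP => u; rewrite /= ffunE.
    by case: (eqVneq u v) => [-> | _]; rewrite ?cx ?valid.
  - exact: valid.
rewrite mulrA; congr (_ * _).
rewrite (bigD1 v) //= [in RHS](bigD1 v) //= ffunE eqxx.
rewrite (eq_bigr (fun u => w (phi u))) => [|u uv]; first by ring.
by rewrite ffunE (negbTE uv).
Qed.

(** Independence is obtained by resampling the values at u and v: this leaves g
    alone and turns k into a constant. *)
Lemma expect_indep2 (R : realFieldType) (T V : finType) (c : V -> T) (w : V -> R)
    (k : V -> V -> R) (g : {ffun T -> V} -> R) (u v : T) :
    (forall v, \sum_(x | c x == v) w x = 1) -> u != v ->
    (forall phi x, g (update phi u x) = g phi) ->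
    (forall phi x, g (update phi v x) = g phi) ->
  expect c w (fun phi => k (phi u) (phi v) * g phi) =
  (\sum_(x | c x == u) \sum_(y | c y == v) w x * w y * k x y) * expect c w g.
Proof.
move=> w1 uv gu gv.
rewrite (expect_resample _ (w1 v)) (expect_resample _ (w1 u)).
rewrite /expect big_distrr; apply: eq_bigr => phi _ /=.
rewrite mulrCA; congr (_ * _); rewrite big_distrl; apply: eq_bigr => x _ /=.
rewrite big_distrr big_distrl; apply: eq_bigr => y _ /=.
by rewrite gv gu !ffunE !eqxx (negbTE uv) !mulrA.
Qed.

(** All the edges of H in S are realised by the choice phi.  Quantifying over
    the elements of f avoids choosing an orientation of f; it makes visible
    that only the values of phi on f matter. *)
Definition joined (R : realType) (T : finType) (e : rel T)
    (G : weighted_blowup R e) (phi : {ffun T -> bvertex G})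
    (S : {set {set T}}) : bool :=
  [forall f in S, forall u in f, forall v in f, e u v ==> bedge (phi u) (phi v)].

Lemma joinedP (R : realType) (T : finType) (e : rel T)
    (G : weighted_blowup R e) (phi : {ffun T -> bvertex G})
    (S : {set {set T}}) :
  reflect (forall f u v, f \in S -> u \in f -> v \in f -> e u v ->
             bedge (phi u) (phi v))
          (joined phi S).
Proof.
apply: (iffP forall_inP) => [H f u v fS uf vf euv | H f fS].
  by move/forall_inP: (H f fS) => /(_ u uf)/forall_inP/(_ v vf)/implyP; apply.
by apply/forall_inP => u uf; apply/forall_inP => v vf; apply/implyP => euv; apply: (H f).
Qed.

Lemma joined_sub (R : realType) (T : finType) (e : rel T)
    (G : weighted_blowup R e) (phi : {ffun T -> bvertex G})
    (S S' : {set {set T}}) :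
  S' \subset S -> joined phi S -> joined phi S'.
Proof.
by move=> /fintype.subsetP sub /joinedP H; apply/joinedP => f u v /sub; apply: H.
Qed.

Lemma joined_update (R : realType) (T : finType) (e : rel T)
    (G : weighted_blowup R e) (S : {set {set T}}) (A : {set T}) a
    (phi : {ffun T -> bvertex G}) x :
  a \in A -> joined (update phi a x) (avoid S A) = joined phi (avoid S A).
Proof.
move=> aA; have off f u : f \in avoid S A -> u \in f -> update phi a x u = phi u.
  rewrite inE => /andP[_ fA] uf; rewrite ffunE; case: eqP => // ua.
  by move/pred0P: fA => /(_ a); rewrite /= aA -ua uf.
apply/joinedP/joinedP => H f u v fS uf vf.
  by rewrite -(off f u) // -(off f v) //; apply: H fS uf vf.
by rewrite (off f u) // (off f v) //; apply: H fS uf vf.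
Qed.

Lemma missing_density (R : realType) (T : finType) (e : rel T)
    (G : weighted_blowup R e) (u v : T) :
  \sum_(x : bvertex G | cluster x == u) \sum_(y | cluster y == v)
     bweight x * bweight y * (~~ bedge x y)%:R = 1 - density G u v.
Proof.
have total : \sum_(x : bvertex G | cluster x == u)
    \sum_(y : bvertex G | cluster y == v) bweight x * bweight y = 1.
  rewrite -[RHS](bweight_sum1 G u); apply: eq_bigr => x _.
  by rewrite -big_distrr /= bweight_sum1 mulr1.
rewrite -[in RHS]total -sumrB; apply: eq_bigr => x _.
rewrite [X in _ - X]big_mkcondr -sumrB; apply: eq_bigr => y _ /=.
by case: (bedge x y); rewrite ?mulr0 ?mulr1 ?subrr ?subr0.
Qed.

Definition prob_joined (R : realType) (T : finType) (e : rel T)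
    (G : weighted_blowup R e) (S : {set {set T}}) : R :=
  expect (@cluster R T e G) (@bweight R T e G) (fun phi => (joined phi S)%:R).

(** If all edges of S - f are realised but f is not, then the edges avoiding f
    are realised and f is missed; the last two events are independent, and the
    second one has probability 1 - density <= 1 - d. *)
Lemma prob_joined_rec (R : realType) (T : finType) (e : rel T)
    (G : weighted_blowup R e) (d : R) (S : {set {set T}}) (f : {set T}) :
    simple_graph e -> (forall u v, e u v -> d <= density G u v) ->
    f \in edge_set e ->
  prob_joined G (S :\ f) - (1 - d) * prob_joined G (avoid S f)
    <= prob_joined G S.
Proof.
move=> [esym eirr] dense fE; set P := prob_joined G.
move/finset.imsetP: fE => [[u v]]; rewrite inE /= => euv fuv.
have uv : u != v by apply: contraTneq euv => ->; rewrite eirr.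
have P0 : 0 <= P (avoid S f).
  apply: sumr_ge0 => phi _; apply: mulr_ge0; last exact: ler0n.
  by apply: prodr_ge0 => z _; apply: bweight_ge0.
have bad : expect (@cluster R T e G) (@bweight R T e G)
     (fun phi => (~~ bedge (phi u) (phi v))%:R * (joined phi (avoid S f))%:R) =
   (1 - density G u v) * P (avoid S f).
  rewrite -missing_density -(expect_indep2 (fun x y => (~~ bedge x y)%:R)) //.
  - exact: bweight_sum1.
  - by move=> phi x; rewrite joined_update // fuv !inE eqxx.
  - by move=> phi x; rewrite joined_update // fuv !inE eqxx orbT.
have : (1 - density G u v) * P (avoid S f) <= (1 - d) * P (avoid S f).
  by rewrite ler_wpM2r // lerD2l lerN2 dense.
rewrite -bad lerBlDr => /(lerD (lexx (P S))); apply: le_trans.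
rewrite /P /prob_joined /expect -big_split /=; apply: ler_sum => phi _; rewrite -mulrDr.
rewrite ler_wpM2l //; first by apply: prodr_ge0 => z _; apply: bweight_ge0.
case DS: (joined phi (S :\ f)); last by rewrite -natrM -natrD ler0n.
have [eS | nS] := boolP (joined phi S); first by rewrite -natrM lerDl ler0n.
have -> : joined phi (avoid S f).
  apply: joined_sub DS; apply: avoid_subD1.
  by apply/finset.set0Pn; exists u; rewrite fuv !inE eqxx.
have -> : bedge (phi u) (phi v) = false.
  apply: contraNF nS => buv; apply/joinedP => g a b gS ag bg eab.
  have [gf | gf] := eqVneq g f; last first.
    by move/joinedP: DS => H; apply: (H g) => //; rewrite !inE gf.
  move: ag bg eab; rewrite gf fuv !inE.
  move=> /orP[]/eqP-> /orP[]/eqP->; rewrite ?eirr //.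
  by have [bsym _] := bedge_simple G; rewrite bsym.
by rewrite add0r mulr1.
Qed.

Lemma transversal_of_matching_gen_gt0 (R : realType) (T : finType) (e : rel T)
    (G : weighted_blowup R e) (d : R) :
    simple_graph e -> d <= 1 -> (forall u v, e u v -> d <= density G u v) ->
    (forall S : {set {set T}}, S \subset edge_set e ->
       0 < (matching_gen R S).[1 - d]) ->
  has_transversal G.
Proof.
move=> es d1 dense Fpos; have [esym eirr] := es.
have E0 : finset.set0 \notin edge_set e.
  by apply/negP => /(card_edge eirr); rewrite cards0.
pose P := prob_joined G.
have d0 : 0 <= 1 - d by rewrite subr_ge0.
have := shearer_ratio (F := fun S => (matching_gen R S).[1 - d]) (P := P) E0 d0
  Fpos _ _ (finset.sub0set _) (fintype.subxx (edge_set e)).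
have -> : P finset.set0 = 1.
  rewrite -(expect1 (bweight_sum1 G)); apply: eq_bigr => phi _.
  by congr (_ * _); case: joinedP => // -[] f u v; rewrite inE.
have -> : (matching_gen R (finset.set0 : {set {set T}})).[1 - d] = 1.
  exact: matching_gen_set0.
rewrite divr1 => ratio.
have /ratio{ratio} : forall (S : {set {set T}}) f, S \subset edge_set e -> f \in S ->
    (matching_gen R S).[1 - d] = (matching_gen R (S :\ f)).[1 - d] -
      (1 - d) * (matching_gen R (avoid S f)).[1 - d].
  move=> S f SE fS; rewrite (matching_gen_rec R fS).
    by rewrite hornerD hornerN hornerM hornerX.
  by apply: contraNneq E0 => <-; apply: (fintype.subsetP SE).
move=> ratio; have /ratio{ratio} : forall (S : {set {set T}}) f,
    S \subset edge_set e -> f \in S -> P (S :\ f) - (1 - d) * P (avoid S f) <= P S.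
  by move=> S f SE fS; apply: prob_joined_rec => //; apply: (fintype.subsetP SE).
rewrite ler_pdivlMr ?Fpos // mul1r => /(lt_le_trans (Fpos _ (fintype.subxx _))) PE.
have [phi /andP[/forallP valid /joinedP joinE] | none] :=
    pickP (fun phi : {ffun T -> bvertex G} =>
      [forall v, cluster (phi v) == v] && joined phi (edge_set e)).
  exists phi; split=> [v | u v euv]; first exact/eqP.
  apply: (joinE [set u; v]); rewrite ?inE ?eqxx ?orbT //.
  by apply/finset.imsetP; exists (u, v); rewrite ?inE.
move: PE; rewrite /P /prob_joined /expect big1 ?ltxx // => phi valid.
by have := none phi; rewrite valid /= => ->; rewrite mulr0.
Qed.

(** * The critical density *)

Lemma edge_or_edgeless (T : finType) (e : rel T) :
  (exists u v, e u v) \/ (forall u v, ~~ e u v).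
Proof.
have [[u v] /= euv | none] := pickP (fun q : T * T => e q.1 q.2).
  by left; exists u, v.
by right => u v; rewrite (none (u, v)).
Qed.

Lemma dcrit_edgeless (R : realType) (T : finType) (e : rel T) :
  (forall u v, ~~ e u v) -> dcrit R e = 0.
Proof.
move=> e0; rewrite /dcrit [X in sup X](_ : _ = classical_sets.set0) ?sup0 //.
apply/seteqP; split=> d //= -[_ [G [_ []]]].
have [phi phiP] := choice (cluster_nonempty G).
by exists phi; split=> // u v; rewrite (negbTE (e0 u v)).
Qed.

(** For a graph with an edge, 0 belongs to the set whose supremum is the critical
    density: take H without its edges, each vertex being its own cluster. *)
Lemma edgeless_blowup (R : realType) (T : finType) (e : rel T) :
    (exists u v, e u v) ->
  exists G : weighted_blowup R e,
    (forall u v, e u v -> 0 <= density G u v) /\ ~ has_transversal G.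
Proof.
move=> [u [v euv]].
have simple0 : simple_graph (fun _ _ : T => false) by [].
have sum1 (a : T) : \sum_(x | id x == a) (1 : R) = 1.
  by rewrite (big_pred1 a).
have ex (a : T) : exists x, id x = a by exists a.
have edges (x y : T) : false -> e (id x) (id y) by [].
exists (@WeightedBlowup R T e T id (fun _ _ => false) (fun=> 1) simple0 ex edges
  (fun=> ler01) sum1); split; last by move=> [phi [_ /(_ _ _ euv)]].
by move=> a b _; apply: sumr_ge0 => x _; apply: sumr_ge0 => y _; apply: mulr_ge0.
Qed.

Lemma dcrit_le (R : realType) (T : finType) (e : rel T) (b : R) :
    simple_graph e -> (exists u v, e u v) ->
    (forall q, 0 <= q < 1 - b -> 0 < (matching_gen R (edge_set e)).[q]) ->
  dcrit R e <= b.
Proof.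
move=> es edge Fpos; apply: ge_sup.
  exists 0; split; first by rewrite lexx ler01.
  exact: edgeless_blowup.
move=> d /= [/andP[d0 d1] [G [dense noT]]]; rewrite leNgt; apply/negP => bd.
apply: noT; apply: (transversal_of_matching_gen_gt0 es d1 dense) => S SE.
apply: matching_gen_gt0_sub SE _ _.
- by apply/negP => /(card_edge (proj2 es)); rewrite cards0.
- by rewrite subr_ge0.
- by move=> y /andP[y0 yd]; apply: Fpos; rewrite y0 /=; lra.
Qed.

Lemma dcrit_le_largest_root (R : realType) (T : finType) (e : rel T) :
    simple_graph e ->
  dcrit R e <= 1 - 1 / (largest_root (matching_poly R e)) ^+ 2.
Proof.
move=> es; have [_ eirr] := es; rewrite div1r; set t := largest_root _.
have [edge | e0] := edge_or_edgeless e; last first.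
  rewrite dcrit_edgeless // subr_ge0; have [-> | t0] := eqVneq t 0.
    by rewrite expr0n invr0 ler01.
  move: t0; rewrite /t /largest_root; case: xgetP => [{}t _ [rt _] t0|]; last by rewrite eqxx.
  have E0 : edge_set e = finset.set0.
    apply/setP => f; rewrite [RHS]inE; apply/negP => /finset.imsetP[[u v]].
    by rewrite inE /= (negbTE (e0 u v)).
  move: rt; rewrite rootE matching_poly_gen // E0 matching_gen_set0 mulr1.
  by rewrite expf_eq0 (negbTE t0) andbF.
(* When t = 0 the bound is 1, because 1 / 0 = 0. *)
have [t0 | t0] := eqVneq t 0.
  rewrite t0 expr0n invr0; apply: dcrit_le => // q; rewrite subr0 subrr.
  by move=> /andP[q0 /(le_lt_trans q0)]; rewrite ltxx.
have [rt tmax] : root (matching_poly R e) t /\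
    forall s, root (matching_poly R e) s -> s <= t.
  by move: t0; rewrite /t /largest_root; case: xgetP => //; rewrite eqxx.
(* The roots are symmetric about 0, so the largest one is nonnegative. *)
have tpos : 0 < t.
  have : root (matching_poly R e) (- t).
    move: rt; rewrite !rootE !matching_poly_gen ?oppr_eq0 // sqrrN !mulf_eq0.
    by rewrite !expf_eq0 oppr_eq0 (negbTE t0) andbF.
  by move=> /tmax; lra.
apply: dcrit_le => // q /andP[q0 qt]; rewrite ltNge; apply/negP => negq.
have [|c /andP[c0 cq] rc] := poly_ivt_decr q0 _ negq.
  by rewrite matching_gen_horner0.
(* A root c < 1 / t ^ 2 of the matching sum would give the root
   1 / sqrt c > t of the matching polynomial. *)
have s0 : 0 < (Num.sqrt c)^-1 by rewrite invr_gt0 sqrtr_gt0.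
have : root (matching_poly R e) (Num.sqrt c)^-1.
  rewrite rootE matching_poly_gen ?lt0r_neq0 // !exprVn invrK sqr_sqrtr ?(ltW c0) //.
  by rewrite (rootP rc) mulr0.
move=> /tmax; rewrite -ler_sqr ?nnegrE ?(ltW s0) ?(ltW tpos) //.
rewrite exprVn sqr_sqrtr ?(ltW c0) // leNgt => /negP; apply.
rewrite -[ltLHS]invrK ltf_pV2 ?posrE ?invr_gt0 ?exprn_gt0 //.
by apply: le_lt_trans cq _; lra.
Qed.

Lemma dcrit_lt_max_degree (R : realType) (T : finType) (e : rel T) (b : nat) :
    simple_graph e -> (exists u v, e u v) -> (0 < b)%N ->
    (max_degree e <= b.+1)%N ->
  dcrit R e < 1 - (4%:R * b%:R)^-1.
Proof.
move=> es edge b0 deg; have [esym eirr] := es.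
set x0 : R := (4%:R * b%:R)^-1.
have bpos : (0 : R) < 4%:R * b%:R by rewrite mulr_gt0 // ltr0n.
have x0pos : 0 < x0 by rewrite invr_gt0.
have Edeg v : (#|[set f in edge_set e | v \in f]| <= b.+1)%N.
  apply: leq_trans deg; apply: leq_trans (leq_bigmax v).
  apply: leq_trans (leq_imset_card (fun u => [set v; u]) _).
  apply: subset_leq_card; apply/fintype.subsetP => f; rewrite inE.
  move=> /andP[/finset.imsetP[[p q]]]; rewrite inE /= => epq -> .
  rewrite !inE => /orP[] /eqP ->.
    by apply/finset.imsetP; exists q; rewrite ?inE.
  by apply/finset.imsetP; exists p; rewrite ?inE 1?esym // finset.setUC.
have Fpos x : 0 <= x <= x0 -> 0 < (matching_gen R (edge_set e)).[x].
  move=> /andP[]; rewrite le_eqVlt => /predU1P[<- _|x_gt0 xx0].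
    by rewrite matching_gen_horner0.
  apply: (proj1 (matching_gen_gt0_degree (card_edge eirr) Edeg b0 x_gt0 _)).
  by rewrite -ler_pdivlMl // mulr1.
(* Either the matching sum has a first root q beyond x0, or it has no root
   there and any q > x0 will do. *)
have [q [x0q Fq]] : exists q, x0 < q /\
    forall x, 0 <= x < q -> 0 < (matching_gen R (edge_set e)).[x].
  case: (pselect (exists2 y, x0 <= y & (matching_gen R (edge_set e)).[y] <= 0)).
    move=> [y x0y negy]; have [|c [/andP[x0c _] _ posc]] := first_root x0y _ negy.
      by apply: Fpos; rewrite lexx ltW.
    exists c; split=> // x /andP[x_ge0 xc]; have [xx0 | x0x] := leP x x0.
      by apply: Fpos; rewrite x_ge0.
    by apply: posc; rewrite (ltW x0x).
  move=> none; exists (x0 + 1); split; first by rewrite ltrDl.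
  move=> x /andP[x_ge0 _]; have [xx0 | x0x] := leP x x0.
    by apply: Fpos; rewrite x_ge0.
  by rewrite ltNge; apply/negP => negx; apply: none; exists x => //; apply: ltW.
apply: (@le_lt_trans _ _ (1 - q)); last by rewrite ltrD2l ltrN2.
by apply: dcrit_le => // x; rewrite opprB addrC subrK => /Fq.
Qed.

Theorem corollary4p5 (R : realType) (T : finType) (e : rel T)
    (esimple : simple_graph e) (econn : connected_graph e) :
  dcrit R e <= 1 - 1 / (largest_root (matching_poly R e)) ^+ 2 /\
  dcrit R e < 1 - 1 / (4%:R * ((max_degree e)%:R - 1)).
Proof.
split; first exact: dcrit_le_largest_root.
rewrite div1r; have [edge | e0] := edge_or_edgeless e; last first.
  have -> : max_degree e = 0%N.
    rewrite /max_degree big1 // => x _; apply: eq_card0 => y.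
    by rewrite inE (negbTE (e0 x y)).
  by rewrite dcrit_edgeless // sub0r mulrN1 invrN opprK addr_gt0 // invr_gt0.
have deg0 : (0 < max_degree e)%N.
  have [u [v euv]] := edge; apply: leq_trans (leq_bigmax u).
  by rewrite card_gt0; apply/finset.set0Pn; exists v; rewrite inE.
case D: (max_degree e) deg0 => [//|[|b]] _.
  (* For maximal degree 1 the bound to prove is 1, again because 1 / 0 = 0, and
     the case of maximal degree at most 2 is more than enough. *)
  rewrite subrr mulr0 invr0 subr0.
  apply: (lt_le_trans (dcrit_lt_max_degree R (b := 1) _ edge _ _)); rewrite ?D //.
  by rewrite gerBl invr_ge0 mulr1.
rewrite -[b.+2%:R]natr1 addrK.
by apply: dcrit_lt_max_degree; rewrite ?D.
Qed.
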